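(* For every integer $n\ge 0$, $c_2(5n+2)\equiv 0 \pmod 2$.
   Context: A partition of $n\ge 0$ is a finite multiset of positive integers summing to $n$. For $n\ge 0$, $c_2(n)$ denotes the number of pairs $(j,\lambda)$, where $j\ge 1$ is an integer and $\lambda$ is a partition of $n$, such that: each of the odd integers $1,3,\dots,2j-1$ appears in $\lambda$ exactly once; every even part of $\lambda$ is greater than $2j$ and the even parts of $\lambda$ are distinct; odd parts $\ge 2j+1$ may appear with any multiplicity. (A single partition is counted once for each $j$ for which these conditions hold.) *)

(* Defs.v *)
From mathcomp Require Import all_boot.
Set Implicit Arguments. Unset Strict Implicit. Unset Printing Implicit Defensive.

(* A partition of n is encoded by its multiplicity function
   m : 'I_n.+1 -> 'I_n.+1, where m i is the number of times the part i
   occurs.  Every part of a partition of n is <= n and every multiplicity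
   is <= n, so this is a bijective encoding of partitions of n
   (finite multisets of positive integers summing to n). *)
Definition is_partition (n : nat) (m : {ffun 'I_n.+1 -> 'I_n.+1}) : bool :=
  (m ord0 == 0 :> nat) && (\sum_(i < n.+1) i * m i == n).

Definition c2_cond (n j : nat) (m : {ffun 'I_n.+1 -> 'I_n.+1}) : bool :=
  [&& 0 < j,
      [forall k : 'I_j, (2 * k + 1 <= n) && (m (inord (2 * k + 1)) == 1 :> nat)] &
      [forall i : 'I_n.+1,
         (~~ odd i && (0 < m i)) ==> ((2 * j < i) && (m i == 1 :> nat))]].

(* c_2(n): number of pairs (j, lambda).  Any valid j satisfies
   j^2 = 1 + 3 + ... + (2j-1) <= n, so j ranges in 'I_n.+1 without loss. *)
Definition c2 (n : nat) : nat :=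
  #|[set jm : 'I_n.+1 * {ffun 'I_n.+1 -> 'I_n.+1} |
      is_partition jm.2 && c2_cond jm.1 jm.2]|.

(* Main.v *)
Require Import Defs.
From HB Require Import structures.
From mathcomp Require Import all_boot all_algebra ring zify.
Set Implicit Arguments. Unset Strict Implicit. Unset Printing Implicit Defensive.
Import GRing.Theory.
Local Open Scope ring_scope.

(** Write P_j for the product over k = 1, ..., j of (1 - q^(2k)) / (1 - q^(2k-1)).
    Modulo 2 the generating function of c_2 is the sum over j >= 1 of
    q^(j^2) P_oo / P_j.  Its missing term j = 0 is Gauss's series of
    q^(s(s+1)/2), s >= 0, obtained here from Shanks's finite identity.  Summed
    over all j >= 0 it is, modulo 2, P_oo times the Goellnitz-Gordon series
    sum of q^(j^2) (-q;q^2)_j / (q^2;q^2)_j, which two steps of the Bailey chain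
    starting at the unit Bailey pair evaluate to the theta series of q^(4r^2+r),
    r in Z.  Neither 4r^2+r nor s(s+1)/2 is ever congruent to 2 modulo 5, since
    16(4r^2+r)+1 and 8 s(s+1)/2 + 1 are squares while 3 and 2 are not squares
    modulo 5.

    Power series modulo q^K are modelled by a commutative ring of
    characteristic 2 with an element q such that q^K = 0: signs disappear, each
    1 + q^i (i > 0) is invertible, and an infinite product is a finite product
    with enough factors. *)

Lemma double_bin2 m : (2 * 'C(m, 2) + m = m ^ 2)%N.
Proof. by elim: m => // m IH; rewrite binS bin1; lia. Qed.

Lemma leq_sqr m : (m <= m ^ 2)%N.
Proof. by nia. Qed.

(** * Truncated q-products and their inverses *)

Section QSeries.

Variables (R : comNzRingType) (q : R) (K : nat).
Hypothesis char2 : 2%N \in [pchar R].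
Hypothesis qK : q ^+ K = 0.

(** The geometric series of [q ^+ i], which for i > 0 inverts [1 + q ^+ i]; its terms beyond K would
    vanish. *)
Definition geom i : R := \sum_(k < K) q ^+ (i * k).

Lemma expq_ge i : (K <= i)%N -> q ^+ i = 0.
Proof. by move=> h; rewrite -(subnKC h) exprD qK mul0r. Qed.

Lemma geomK i : (0 < i)%N -> (1 + q ^+ i) * geom i = 1.
Proof.
move=> i0; have -> : geom i = \sum_(k < K) (q ^+ i) ^+ k.
  by apply: eq_bigr => k _; rewrite exprM.
rewrite -[X in 1 + X](oppr_pchar2 char2) -opprB mulNr -subrX1 -exprM.
by rewrite expq_ge ?leq_pmull // sub0r opprK.
Qed.

(** With signs invisible, [pe n] is (q^2;q^2)_n and [po n] is (q;q^2)_n; [ie] and [io] are their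
    inverses, so that P_n is [pe n * io n]. *)
Definition pe n : R := \prod_(i < n) (1 + q ^+ (2 * i + 2)).
Definition po n : R := \prod_(i < n) (1 + q ^+ (2 * i + 1)).
Definition ie n : R := \prod_(i < n) geom (2 * i + 2).
Definition io n : R := \prod_(i < n) geom (2 * i + 1).

Lemma peS n : pe n.+1 = pe n * (1 + q ^+ (2 * n + 2)).
Proof. exact: big_ord_recr. Qed.
Lemma poS n : po n.+1 = po n * (1 + q ^+ (2 * n + 1)).
Proof. exact: big_ord_recr. Qed.

Lemma peK n : pe n * ie n = 1.
Proof. by rewrite -big_split /= big1 // => i _; rewrite geomK // addn2. Qed.
Lemma poK n : po n * io n = 1.
Proof. by rewrite -big_split /= big1 // => i _; rewrite geomK // addn1. Qed.

Lemma ieE n : ie n = (1 + q ^+ (2 * n + 2)) * ie n.+1.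
Proof. by rewrite /ie big_ord_recr /= mulrCA geomK ?mulr1 // addn2. Qed.
Lemma ioE n : io n = (1 + q ^+ (2 * n + 1)) * io n.+1.
Proof. by rewrite /io big_ord_recr /= mulrCA geomK ?mulr1 // addn1. Qed.

(** * Gaussian binomials in base q^2 and the q-Chu-Vandermonde sum *)

Local Notation Q := (q ^+ 2).

Fixpoint qbin M m : R :=
  match M, m with
  | _, 0 => 1
  | 0, _.+1 => 0
  | M'.+1, m'.+1 => qbin M' m'.+1 + Q ^+ (M' - m') * qbin M' m'
  end.

Lemma qbin0 M : qbin M 0 = 1. Proof. by case: M. Qed.

Lemma qbin_gt M m : (M < m)%N -> qbin M m = 0.
Proof.
elim: M m => [|M IH] [|m] //= h; by rewrite !IH ?mulr0 ?addr0 // ltnW.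
Qed.

(** Pascal's rule multiplies [pe M] by 1 + Q^(M-m) and by Q^(M-m) + q^(2M+2); in characteristic 2
    these add up to the new factor 1 + q^(2M+2). *)
Lemma qbin_prod M m : (m <= M)%N -> qbin M m * pe m * pe (M - m) = pe M.
Proof.
elim: M m => [|M IH] [|m] //= h; rewrite ?subn0 /pe ?big_ord0 ?mul1r //.
rewrite -/(pe _) -/(pe _) -/(pe _) subSS.
move: h; rewrite ltnS leq_eqVlt => /orP[/eqP ->|h].
  rewrite qbin_gt // subnn add0r mul1r /pe big_ord0 mulr1.
  rewrite -/(pe _) !peS mulrA; have := IH M (leqnn M).
  by rewrite subnn /pe big_ord0 mulr1 => ->.
have e1 := IH _ h; have e2 := IH _ (ltnW h).
rewrite !mulrDl -mulrA [X in _ + X = _]mulrAC peS.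
have -> : qbin M m.+1 * (pe m * (1 + q ^+ (2 * m + 2)) * pe (M - m))
   = pe M * (1 + Q ^+ (M - m)).
  rewrite -e1 (_ : M - m = (M - m.+1).+1)%N; last by lia.
  rewrite !peS -exprM (_ : 2 * (M - m.+1).+1 = 2 * (M - m.+1) + 2)%N; last by lia.
  ring.
have -> : Q ^+ (M - m) * qbin M m * pe (M - m) * (pe m * (1 + q ^+ (2 * m + 2)))
   = pe M * (Q ^+ (M - m) + q ^+ (2 * M + 2)).
  rewrite -e2 (_ : 2 * M + 2 = 2 * (M - m) + (2 * m + 2))%N; last by lia.
  rewrite (exprD q (2 * (M - m))) (exprM q 2); ring.
rewrite peS -mulrDr; congr (_ * _).
by rewrite addrA addrK_pchar2.
Qed.

(* q-Chu-Vandermonde in homogeneous form: b = 0 and b = q^(2r+1) with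
   e = q^(4r+2) give the two conjugate Bailey pairs below. *)
Lemma q_chu_vandermonde M b e :
  \sum_(m < M.+1) qbin M m * (\prod_(i < m) (b + e * Q ^+ i))
     * Q ^+ 'C(m, 2) * \prod_(m <= i < M) (1 + e * Q ^+ i)
  = \prod_(i < M) (1 + b * Q ^+ i).
Proof.
elim: M e => [|M IH] e.
  by rewrite big_ord_recl !big_ord0 big_geq //= !mulr1 addr0.
pose X m := (\prod_(i < m) (b + e * Q ^+ i)) * Q ^+ 'C(m, 2)
              * \prod_(m <= i < M.+1) (1 + e * Q ^+ i).
(* Pascal's rule splits the sum in two: the first half reduces to the induction hypothesis at [e],
   the second to the one at [e * Q]. *)
transitivity (qbin M 0 * X 0%N + \sum_(i < M.+1)
    (qbin M i.+1 * X i.+1 + Q ^+ (M - i) * qbin M i * X i.+1)).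
  rewrite big_ord_recl; congr (_ + _).
    by rewrite /X -!mulrA /= qbin0.
  by apply: eq_bigr => i _; rewrite -mulrDl /X -!mulrA.
rewrite big_split /= addrA.
have -> : qbin M 0 * X 0%N + \sum_(i < M.+1) qbin M i.+1 * X i.+1
   = (1 + e * Q ^+ M) * \prod_(i < M) (1 + b * Q ^+ i).
  rewrite -(IH e) -(big_ord_recl M.+1 (fun i : 'I_M.+2 => qbin M i * X i)).
  rewrite big_ord_recr /= qbin_gt // mul0r addr0 big_distrr /=.
  apply: eq_bigr => i _; rewrite /X big_nat_recr /=; last by rewrite -ltnS.
  ring.
have -> : \sum_(i < M.+1) Q ^+ (M - i) * qbin M i * X i.+1
   = Q ^+ M * (b + e) * \prod_(i < M) (1 + b * Q ^+ i).
  rewrite -(IH (e * Q)) big_distrr /=; apply: eq_bigr => i _.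
  rewrite /X big_ord_recl expr0 mulr1 big_add1 /= binS bin1 exprD.
  under eq_bigr => k _ do rewrite /bump add1n exprS mulrA.
  under eq_big_nat => k _ do rewrite exprS mulrA.
  have -> : Q ^+ M = Q ^+ (M - i) * Q ^+ i by rewrite -exprD subnK // -ltnS.
  ring.
rewrite -mulrDl big_ord_recr /= mulrC; congr (_ * _).
(* [ring] does not use the characteristic, so the surplus is displayed as a double and then
   cancelled. Later computations do the same. *)
have -> : 1 + e * Q ^+ M + Q ^+ M * (b + e)
  = 1 + b * Q ^+ M + (e * Q ^+ M + e * Q ^+ M) by ring.
by rewrite addrr_pchar2 // addr0.
Qed.

(** * Bailey kernels, the Bailey transform and the unit Bailey pair *)

Lemma qbin_ie M m : (m <= M)%N -> qbin M m = pe M * ie m * ie (M - m).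
Proof.
move=> /qbin_prod <-.
have -> : qbin M m * pe m * pe (M - m) * ie m * ie (M - m)
  = qbin M m * (pe m * ie m) * (pe (M - m) * ie (M - m)) by ring.
by rewrite !peK !mulr1.
Qed.

Lemma pe_prod m M a : (m <= M)%N ->
  \prod_(m <= i < M) (1 + q ^+ (2 * a + 2) * Q ^+ i) = pe (a + M) * ie (a + m).
Proof.
elim: M => [|M IH].
  by rewrite leqn0 => /eqP ->; rewrite big_geq // peK.
rewrite leq_eqVlt ltnS => /orP[/eqP ->|h]; first by rewrite big_geq // peK.
rewrite big_nat_recr //= IH // (addnS a) peS -exprM -exprD.
by rewrite (_ : 2 * a + 2 + 2 * M = 2 * (a + M) + 2)%N; [ring|lia].
Qed.

(** For e = q^(4r+2) the tail product is a quotient of two values of [pe]; dividing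
    q-Chu-Vandermonde by [pe M] and [pe (2 * r + M)] leaves the Bailey kernel. *)
Lemma q_chu_vandermonde_inv r M b :
  \sum_(m < M.+1) (\prod_(i < m) (b + q ^+ (4 * r + 2) * Q ^+ i))
     * Q ^+ 'C(m, 2) * (ie (M - m) * ie m * ie (2 * r + m))
  = (\prod_(i < M) (1 + b * Q ^+ i)) * (ie M * ie (2 * r + M)).
Proof.
rewrite -(q_chu_vandermonde M b (q ^+ (4 * r + 2))) big_distrl /=.
apply: eq_bigr => m _; have hm : (m <= M)%N by rewrite -ltnS.
rewrite qbin_ie // (_ : 4 * r + 2 = 2 * (2 * r) + 2)%N; last by lia.
rewrite pe_prod //; set B := \prod_(i < m) _; set C := Q ^+ _.
have -> : pe M * ie m * ie (M - m) * B * C * (pe (2 * r + M) * ie (2 * r + m))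
    * (ie M * ie (2 * r + M)) = B * C * (ie (M - m) * ie m * ie (2 * r + m))
    * (pe M * ie M) * (pe (2 * r + M) * ie (2 * r + M)) by ring.
by rewrite !peK !mulr1.
Qed.

(* Bailey's lemma relative to a = 1 in base q^2, stated as the evaluation of the
   kernel sum that it needs. *)
Definition bailey w v V := forall r n, (r <= n)%N ->
  \sum_(r <= m < n.+1) w m * (ie (n - m) * ie (m - r) * ie (m + r))
   = v r * V n * (ie (n - r) * ie (n + r)).

Lemma bailey_shift w v V :
  (forall r M, \sum_(m < M.+1) w (r + m)%N * (ie (M - m) * ie m * ie (2 * r + m))
    = v r * V (r + M)%N * (ie M * ie (2 * r + M))) -> bailey w v V.
Proof.
move=> H r n hr; rewrite -(subnKC hr); move: (n - r)%N => M.
rewrite -{1}[r]add0n big_addn big_mkord addKn.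
rewrite (_ : (r + M).+1 - r = M.+1)%N; last by lia.
rewrite (_ : r + M + r = 2 * r + M)%N; last by lia.
rewrite -H; apply: eq_bigr => m _.
rewrite addnK [(m + r)%N]addnC subnDl.
by rewrite (_ : r + m + r = 2 * r + m)%N; last by lia.
Qed.

(** The case b = 0; the exponents match because 2(r+m)^2 = 2r^2 + (4r+2)m + 4 binom(m,2). *)
Lemma bailey_sq : bailey (fun m => Q ^+ (m ^ 2)) (fun r => Q ^+ (r ^ 2)) (fun _ => 1).
Proof.
apply: bailey_shift => r M; rewrite mulr1.
have := q_chu_vandermonde_inv r M 0.
rewrite [X in _ = X * _]big1; last by move=> i _; rewrite mul0r addr0.
rewrite mul1r => <-; rewrite big_distrr /=; apply: eq_bigr => m _.
rewrite !mulrA; congr (_ * _ * _ * _).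
under eq_bigr => i _ do rewrite add0r.
rewrite big_split /= prodr_const card_ord.
rewrite prodrXr -(big_mkord xpredT id) bin2_sum -!exprM -!exprD.
by congr (_ ^+ _); have := double_bin2 m; nia.
Qed.

(** The case b = q^(2r+1): since q^(4r+2) = b^2, each factor b + b^2 Q^i is b(1 + b Q^i), and the
    products of 1 + b Q^i extend [po r]. *)
Lemma bailey_po : bailey (fun m => q ^+ (m ^ 2) * po m) (fun r => q ^+ (r ^ 2)) po.
Proof.
apply: bailey_shift => r M.
have po_prod m : \prod_(i < m) (1 + q ^+ (2 * r + 1) * Q ^+ i) * po r = po (r + m).
  elim: m => [|m IH]; first by rewrite big_ord0 mul1r addn0.
  rewrite big_ord_recr /= (addnS r) poS -IH -exprM -exprD.
  by rewrite (_ : 2 * r + 1 + 2 * m = 2 * (r + m) + 1)%N; [ring|lia].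
transitivity (q ^+ (r ^ 2) * po r * ((\prod_(i < M) (1 + q ^+ (2 * r + 1) * Q ^+ i))
    * (ie M * ie (2 * r + M)))); last by rewrite -po_prod; ring.
rewrite -(q_chu_vandermonde_inv r M) big_distrr /=.
apply: eq_bigr => m _; rewrite -po_prod.
have -> : \prod_(i < m) (q ^+ (2 * r + 1) + q ^+ (4 * r + 2) * Q ^+ i) =
  q ^+ ((2 * r + 1) * m) * \prod_(i < m) (1 + q ^+ (2 * r + 1) * Q ^+ i).
  have -> : q ^+ ((2 * r + 1) * m) = \prod_(i < m) q ^+ (2 * r + 1).
    by rewrite prodr_const card_ord exprM.
  rewrite -big_split /=.
  apply: eq_bigr => i _; rewrite (_ : 4 * r + 2 = (2 * r + 1) + (2 * r + 1))%N.
    by rewrite !exprD; ring.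
  by lia.
have -> : ((r + m) ^ 2 =
    r ^ 2 + ((2 * r + 1) * m + 2 * 'C(m, 2)))%N by have := double_bin2 m; nia.
rewrite !(exprD q (r ^ 2)) (exprD q ((2 * r + 1) * m)) (exprM q 2); ring.
Qed.

(** One step of the Bailey chain: insert the expansion of [beta] and exchange the sums; the inner
    sum is the one evaluated by [bailey]. *)
Lemma bailey_transform w v V (alpha beta : nat -> R) n : bailey w v V ->
  (forall m, beta m = \sum_(r < m.+1) alpha r * (ie (m - r) * ie (m + r))) ->
  \sum_(m < n.+1) w m * ie (n - m) * beta m
  = V n * \sum_(r < n.+1) alpha r * v r * (ie (n - r) * ie (n + r)).
Proof.
move=> H hb; pose F m r := w m * ie (n - m) * (alpha r * (ie (m - r) * ie (m + r))).
transitivity (\sum_(0 <= m < n.+1) \sum_(0 <= r < n.+1 | (r <= m)%N) F m r).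
  rewrite big_mkord; apply: eq_bigr => m _; rewrite hb big_distrr /=.
  rewrite -(big_mkord xpredT (F m)) (big_nat_widen _ _ n.+1); first by [].
  exact: ltn_ord.
rewrite (exchange_big_dep_nat xpredT) //= big_mkord big_distrr /=.
apply: eq_bigr => r _; have hr : (r <= n)%N by rewrite -ltnS.
transitivity (alpha r * (v r * V n * (ie (n - r) * ie (n + r)))); last by ring.
rewrite -(H _ _ hr) big_distrr /= [RHS](big_nat_widenl _ 0%N) //.
by apply: eq_bigr => m _; rewrite /F; ring.
Qed.

(* The terms of index r and -r of the unit Bailey pair, added together. *)
Definition alpha_unit r : R :=
  if r is r'.+1 then q ^+ (r * r') * (1 + q ^+ (2 * r)) else 1.

(** Multiplying by [1 + q ^+ (2 * m)] makes every proper partial sum a single term, so induction on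
    s applies. *)
Lemma alpha_unit_partial m s : (s < m)%N ->
  (1 + q ^+ (2 * m)) * \sum_(r < s.+1) alpha_unit r * (ie (m - r) * ie (m + r))
  = q ^+ (s.+1 * s) * (ie (m - s.+1) * ie (m + s)).
Proof.
elim: s => [|s IH] hs.
  rewrite big_ord1 subn0 addn0 !mul1r subn1.
  by rewrite [ie m.-1]ieE prednK // (_ : 2 * m.-1 + 2 = 2 * m)%N; [ring|lia].
rewrite big_ord_recr /= mulrDr IH ?(ltnW hs) //.
have [k hk] : exists k, m = (s.+2 + k)%N by exists (m - s.+2)%N; lia.
have -> : (m - s.+1 = k.+1)%N by lia.
have -> : (m - s.+2 = k)%N by lia.
rewrite (ieE k) (ieE (m + s)) -addnS.
have -> : (2 * (m + s) + 2 = 2 * m + 2 * s.+1)%N by lia.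
have -> : (s.+2 * s.+1 = s.+1 * s + 2 * s.+1)%N by lia.
have -> : (2 * m = 2 * s.+1 + (2 * k + 2))%N by lia.
move: (s.+1 * s)%N (2 * s.+1)%N (2 * k + 2)%N => a b c; rewrite !exprD.
set x := q ^+ b; set y := q ^+ c; set z := q ^+ a; set u := ie _; set v := ie _.
transitivity (z * x * ((1 + y) * u * v) + (1 + x * x * y) * z * u * v
   + (1 + x * x * y) * z * u * v); first by ring.
by rewrite -addrA addrr_pchar2 // addr0; ring.
Qed.

(** For m > 0 the closed form at s = m - 1 cancels the last term r = m, once both carry the
    invertible factor [1 + q ^+ (2 * m)]. *)
Lemma alpha_unit_sum m :
  \sum_(r < m.+1) alpha_unit r * (ie (m - r) * ie (m + r)) = (m == 0%N)%:R.
Proof.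
case: m => [|m]; first by rewrite big_ord1 /ie !big_ord0 !mulr1.
rewrite -[LHS]mul1r -[X in X * _](@geomK (2 * m.+1)) // [1 + _]lock mulrAC -lock.
rewrite big_ord_recr /= mulrDr alpha_unit_partial // !subnn addSnnS.
rewrite (ieE (m + m.+1)) -addSn.
have -> : (2 * (m + m.+1) + 2 = 2 * m.+1 + 2 * m.+1)%N by lia.
rewrite exprD; set x := q ^+ (2 * m.+1).
set z := q ^+ _; set u := ie _; set v := ie _.
set w := z * u * v.
transitivity (geom (2 * m.+1) *
    ((w * (1 + x * x) + w * (1 + x * x)) + (w * x + w * x))).
  by rewrite /w; ring.
by rewrite !addrr_pchar2 // mulr0.
Qed.

(** * Two steps along the Bailey chain, up to the Goellnitz-Gordon series *)

Lemma euler_pair n :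
  ie n = \sum_(r < n.+1) alpha_unit r * Q ^+ (r ^ 2) * (ie (n - r) * ie (n + r)).
Proof.
have := bailey_transform n bailey_sq (fun m => esym (alpha_unit_sum m)).
(* The unit pair has beta_m = 0 for m > 0, so only the term m = 0 survives. *)
rewrite mul1r => <-; rewrite big_ord_recl big1 ?addr0 => [|i _]; last by rewrite mulr0.
by rewrite subn0 mulr1 mul1r.
Qed.

(* q^(4r^2-r) + q^(4r^2+r) for r > 0, and 1 for r = 0. *)
Definition theta r : R := alpha_unit r * Q ^+ (r ^ 2) * q ^+ (r ^ 2).

Lemma goellnitz_gordon_finite n :
  \sum_(m < n.+1) q ^+ (m ^ 2) * po m * ie (n - m) * ie m
  = po n * \sum_(r < n.+1) theta r * (ie (n - r) * ie (n + r)).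
Proof.
exact (bailey_transform (alpha := fun r => alpha_unit r * Q ^+ (r ^ 2))
  n bailey_po euler_pair).
Qed.

Lemma geom_ge i : (K <= i)%N -> (0 < i)%N -> geom i = 1.
Proof. by move=> h /geomK; rewrite expq_ge // addr0 mul1r. Qed.

Lemma ie_ge a b : (K <= a)%N -> (a <= b)%N -> ie b = ie a.
Proof.
move=> ha; elim: b => [|b IH]; first by rewrite leqn0 => /eqP ->.
rewrite leq_eqVlt ltnS => /orP[/eqP -> //|h]; rewrite -IH // [RHS]ieE.
by rewrite expq_ge ?addr0 ?mul1r //; lia.
Qed.

(** The limit of the finite identity, N acting as infinity: the factor q^(m^2) kills every m >= K,
    and for m < K the index N - m is still at least K, where [ie] is constant. *)
Lemma goellnitz_gordon N : (2 * K <= N)%N ->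
  \sum_(m < N.+1) q ^+ (m ^ 2) * (pe N * io N * (po m * ie m))
  = \sum_(r < N.+1) theta r.
Proof.
move=> hN; have ieN m : (m < K)%N -> ie (N - m) = ie N.
  by move=> h; rewrite -(@ie_ge (N - m) N) //; lia.
have sqK m : (K <= m)%N -> q ^+ (m ^ 2) = 0.
  by move=> h; rewrite expq_ge // (leq_trans h) // leq_sqr.
transitivity (pe N * pe N * io N *
  \sum_(m < N.+1) q ^+ (m ^ 2) * po m * ie (N - m) * ie m).
  rewrite big_distrr /=; apply: eq_bigr => m _.
  case: (ltnP m K) => h; last by rewrite sqK // !(mul0r, mulr0).
  rewrite ieN //.
  transitivity ((pe N * ie N) * (q ^+ (m ^ 2) * (pe N * io N * (po m * ie m))));
    last by ring.
  by rewrite peK mul1r.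
rewrite goellnitz_gordon_finite mulrA big_distrr /=; apply: eq_bigr => r _.
case: (ltnP r K) => h; last by rewrite /theta sqK // !(mul0r, mulr0).
rewrite ieN // (@ie_ge N (N + r)) ?leq_addr //; last by lia.
transitivity ((pe N * ie N) * (pe N * ie N) * (po N * io N) * theta r); first by ring.
by rewrite !peK poK !mul1r.
Qed.

(** * Shanks's finite form of Gauss's triangular series *)

Definition shanks_term n s : R := pe n * io n * (po s * ie s) * q ^+ (s * (2 * n + 1)).

(** The summand is P_n / P_s q^(s(2n+1)). Its differences between n + 1 and n telescope in s, and
    the boundary term at k = 0 vanishes because 1 + q^0 = 0. *)
Lemma shanks_partial n k :
  \sum_(s < k) shanks_term n.+1 s = \sum_(s < k) shanks_term n s
  + q ^+ (k * (2 * n + 1)) * (1 + q ^+ (2 * k)) * (po k * ie k * pe n * io n.+1).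
Proof.
elim: k => [|k IH].
  by rewrite !big_ord0 muln0 expr0 addrr_pchar2 // !(mulr0, mul0r) addr0.
rewrite !big_ord_recr /= IH -!addrA; congr (_ + _).
rewrite /shanks_term peS poS (ioE n) (ieE k).
have -> : (k * (2 * n.+1 + 1) = k * (2 * n + 1) + 2 * k)%N by lia.
have -> : (k.+1 * (2 * n + 1) = k * (2 * n + 1) + (2 * n + 1))%N by lia.
have -> : (2 * k.+1 = 2 * k + 2)%N by lia.
move: (k * _)%N => a; move: (2 * n)%N (2 * k)%N => b c.
rewrite !exprD expr1; set x := q ^+ b; set y := q ^+ c; set z := q ^+ a.
set u := ie _; set v := io _; set p := pe _; set o := po _.
set C := p * v * o * u * (1 + y * q ^+ 2) * z.
transitivity (C * (1 + y * x * q ^+ 2) + (C * y + C * y)).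
  by rewrite /C; ring.
transitivity (C * (1 + y * x * q ^+ 2) + (C * (x * q) + C * (x * q))); last first.
  by rewrite /C; ring.
by rewrite !addrr_pchar2.
Qed.

(** Passing from n to n + 1 adds two triangular exponents: n(2n+1) from the term s = n, and
    (n+1)(2n+1) from the boundary term of [shanks_partial]. *)
Lemma shanks_identity n :
  \sum_(s < n) shanks_term n s = \sum_(s < 2 * n) q ^+ 'C(s.+1, 2).
Proof.
elim: n => [|n IH]; first by rewrite !big_ord0.
rewrite shanks_partial big_ord_recr /= IH (_ : 2 * n.+1 = (2 * n).+2)%N; last by lia.
rewrite !big_ord_recr /= -!addrA; congr (_ + (_ + _)).
  transitivity ((pe n * ie n) * (po n * io n) * q ^+ (n * (2 * n + 1))).
    by rewrite /shanks_term; ring.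
  by rewrite peK poK !mul1r; congr (_ ^+ _); have := double_bin2 (2 * n).+1; nia.
transitivity ((pe n.+1 * ie n.+1) * (po n.+1 * io n.+1) * q ^+ (n.+1 * (2 * n + 1))).
  by rewrite peS (_ : 2 * n + 2 = (2 * n).+2)%N; [ring|lia].
by rewrite peK poK !mul1r; congr (_ ^+ _); have := double_bin2 (2 * n).+2; nia.
Qed.

(** For N >= K every term s > 0 of Shanks's sum contains a vanishing power of q, and the term s = 0
    is P_N. *)
Lemma gauss_triangular N : (0 < N)%N -> (K <= N)%N ->
  pe N * io N = \sum_(s < 2 * N) q ^+ 'C(s.+1, 2).
Proof.
move=> N0 h; rewrite -shanks_identity -(prednK N0) big_ord_recl /= prednK //.
rewrite big1 ?addr0 => [|i _].
  by rewrite /shanks_term mul0n mulr1 /po /ie !big_ord0 !mulr1.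
by rewrite /shanks_term expq_ge ?mulr0 // /bump; nia.
Qed.

End QSeries.

(** * The generating function of c_2 modulo 2 *)

Definition c2_allowed (j i a : nat) : bool :=
  if odd i then (i < 2 * j)%N ==> (a == 1)%N
  else (a == 0)%N || (2 * j < i)%N && (a == 1)%N.

(** The bound on j says 2j - 1 <= n, so the forced odd parts are all indices and the conditions
    decouple over the parts. *)
Lemma c2_cond_family n j (m : {ffun 'I_n.+1 -> 'I_n.+1}) :
  (0 < j)%N -> (2 * j <= n.+1)%N ->
  (m ord0 == 0 :> nat) && c2_cond j m
  = (m \in family (fun i a : 'I_n.+1 => c2_allowed j i a)).
Proof.
move=> j0 hj; apply/idP/familyP => [/andP[_ /and3P[_ /forallP ho /forallP he]] i|hm].
  rewrite unfold_in /c2_allowed; case: ifPn => [io|ie].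
    apply/implyP => ij; have kj : (i./2 < j)%N by lia.
    have /andP[_] := ho (Ordinal kj); rewrite /=.
    have -> : (2 * i./2 + 1 = i)%N by lia.
    by rewrite inord_val.
  have := he i; rewrite ie /=; case: (eqVneq (m i : nat) 0%N) => //= mi0.
  by rewrite lt0n mi0.
have hm' (i : 'I_n.+1) : c2_allowed j i (m i) by have := hm i; rewrite unfold_in.
(* The index 0 is even and not above 2j, so [c2_allowed] already gives it multiplicity 0. *)
apply/andP; split; first by have := hm' ord0; rewrite /c2_allowed /= orbF.
apply/and3P; split=> //; apply/forallP => k.
  have hk : (2 * k + 1 <= n)%N by have := ltn_ord k; lia.
  rewrite hk /=; have := hm' (inord (2 * k + 1)).
  rewrite /c2_allowed inordK ?ltnS // ifT; last by lia.
  by move=> /implyP; apply; have := ltn_ord k; lia.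
apply/implyP => /andP[ke]; rewrite lt0n => mk0.
by have := hm' k; rewrite /c2_allowed (negbTE ke) (negbTE mk0).
Qed.

Section GeneratingFunction.

Variables (R : comNzRingType) (q : R) (n : nat) (phi : {additive R -> 'F_2}).
Hypothesis char2 : 2%N \in [pchar R].
Hypothesis qK : q ^+ n.+1 = 0.
Hypothesis phi_exp : forall m, phi (q ^+ m) = (m == n)%:R.
Hypothesis n_gt0 : (0 < n)%N.

Local Notation K := n.+1.
Local Notation geom := (geom q K).
Local Notation ie := (ie q K).
Local Notation io := (io q K).
Local Notation pe := (pe q).
Local Notation po := (po q).

Definition c2_factor j i : R :=
  if odd i then (if (i < 2 * j)%N then q ^+ i else geom i)
  else if (2 * j < i)%N then 1 + q ^+ i else 1.

Lemma c2_factorE j (i : 'I_K) :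
  \sum_(a : 'I_K | c2_allowed j i a) q ^+ (i * a) = c2_factor j i.
Proof.
have h1 : (1 < K)%N by [].
rewrite /c2_allowed /c2_factor; case: ifPn => io; case: ltnP => ij //=.
- by rewrite (big_pred1 (Ordinal h1)) /= ?muln1.
- rewrite (bigD1 ord0) //= muln0 (big_pred1 (Ordinal h1)) /= ?muln1 //.
  by case=> [[|[|]]].
- rewrite (big_pred1 ord0) /= ?muln0 //.
  by case=> [[|]].
Qed.

Lemma c2_factor_ge j i : (2 * j <= K)%N -> (K <= i)%N -> c2_factor j i = 1.
Proof.
move=> hj hi; rewrite /c2_factor; case: ifPn => _; case: ltnP => h //.
- by lia.
- by rewrite (geom_ge char2 qK) //; lia.
- by rewrite (expq_ge qK) ?addr0.
Qed.

Lemma prod_parity (f : nat -> R) N :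
  \prod_(i < (2 * N).+1) f i
  = f 0%N * ((\prod_(k < N) f (2 * k + 1)%N) * \prod_(k < N) f (2 * k + 2)%N).
Proof.
elim: N => [|N IH]; first by rewrite big_ord1 !big_ord0 !mulr1.
rewrite (_ : 2 * N.+1 = (2 * N).+2)%N; last by lia.
rewrite 2!big_ord_recr /= IH [X in _ = _ * (X * _)]big_ord_recr.
rewrite [X in _ = _ * (_ * X)]big_ord_recr /= addn1 addn2; ring.
Qed.

(** Induction from N = j, where the first j odd numbers sum to j^2 and [po j] cancels [io j]; each
    later factor extends [io]. *)
Lemma prod_c2_factor_odd j N : (j <= N)%N ->
  \prod_(k < N) c2_factor j (2 * k + 1) = q ^+ (j ^ 2) * po j * io N.
Proof.
elim: N => [|N IH].
  by rewrite leqn0 => /eqP ->; rewrite /po /io !big_ord0 !mulr1.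
rewrite leq_eqVlt ltnS => /orP[/eqP ->|h].
  rewrite -mulrA (poK char2 qK) mulr1.
  transitivity (\prod_(k < N.+1) q ^+ (2 * k + 1)).
    apply: eq_bigr => k _; rewrite /c2_factor ifT; last by lia.
    by rewrite ifT //; have := ltn_ord k; lia.
  rewrite prodrXr; congr (_ ^+ _); elim: N.+1 => [|m IHm]; first by rewrite big_ord0.
  by rewrite big_ord_recr /= IHm; lia.
rewrite big_ord_recr /= IH // /c2_factor ifT; last by lia.
by rewrite ifF ?[in RHS]/io ?big_ord_recr /= ?mulrA //; lia.
Qed.

Lemma prod_c2_factor_even j N : (j <= N)%N ->
  \prod_(k < N) c2_factor j (2 * k + 2) = pe N * ie j.
Proof.
elim: N => [|N IH].
  by rewrite leqn0 => /eqP ->; rewrite /pe /ie !big_ord0 !mulr1.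
rewrite leq_eqVlt ltnS => /orP[/eqP ->|h].
  rewrite (peK char2 qK) big1 // => k _; rewrite /c2_factor ifF; last by lia.
  by rewrite ifF //; have := ltn_ord k; lia.
rewrite big_ord_recr /= IH // /c2_factor ifF; last by lia.
by rewrite ifT ?peS; [ring|lia].
Qed.

Lemma prod_c2_factor j N : (2 * j <= K)%N -> (K <= N)%N ->
  \prod_(i < K) c2_factor j i = q ^+ (j ^ 2) * (pe N * io N * (po j * ie j)).
Proof.
move=> hj hN; transitivity (\prod_(i < (2 * N).+1) c2_factor j i).
  rewrite -!(big_mkord xpredT (c2_factor j)).
  rewrite [RHS](@big_cat_nat _ _ _ K) //=; last by lia.
  have -> : \prod_(K <= i < (2 * N).+1) c2_factor j i = 1.
    by rewrite big_nat big1 // => i /andP[hi _]; exact: c2_factor_ge.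
  by rewrite mulr1.
rewrite prod_parity prod_c2_factor_odd ?prod_c2_factor_even; try lia.
rewrite /c2_factor /= mul1r; ring.
Qed.

(** Expanding the product over parts of sums over multiplicities gives a sum of q^(weight of m) over
    functions m, from which [phi] selects weight n. *)
Lemma c2_fiber (j : 'I_K) N : (K <= N)%N ->
  \sum_(m : {ffun 'I_K -> 'I_K} | is_partition m && c2_cond j m) 1
  = phi (if (0 < j)%N then q ^+ (j ^ 2) * (pe N * io N * (po j * ie j)) else 0).
Proof.
move=> hN; case: ifPn => [j0|]; last first.
  rewrite raddf0 => /negbTE j0; rewrite big_pred0 // => m.
  by rewrite /c2_cond j0 andbF.
(* If 2j > K the part 2j - 1 exceeds n, so no partition qualifies; the power of q also vanishes, as
   j^2 >= 2j - 1 >= K. *)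
case: (leqP (2 * j) K) => hj; last first.
  rewrite (expq_ge qK) ?mul0r ?raddf0; last by nia.
  rewrite big_pred0 // => m; apply/negbTE; rewrite negb_and; apply/orP; right.
  apply/negP => /and3P[_ /forallP ho _].
  have kj : (j.-1 < j)%N by lia.
  by have /andP[/=] := ho (Ordinal kj); lia.
rewrite -prod_c2_factor //.
have -> : \prod_(i < K) c2_factor j i =
    \prod_(i < K) \sum_(a : 'I_K | c2_allowed j i a) q ^+ (i * a).
  by apply: eq_bigr => i _; rewrite c2_factorE.
rewrite bigA_distr_big_dep raddf_sum /=.
rewrite [RHS](eq_bigr (fun m : {ffun 'I_K -> 'I_K} =>
    if (\sum_(i < K) i * m i == n)%N then 1 else 0)); last first.
  by move=> m _; rewrite prodrXr phi_exp; case: eqP.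
rewrite -big_mkcondr /=; apply: eq_bigl => m.
rewrite -c2_cond_family // /is_partition; case: (m ord0 == 0 :> nat) => //=.
by rewrite andbC.
Qed.

Lemma c2_mod2 N : (K <= N)%N ->
  (c2 n)%:R = phi (\sum_(1 <= j < N.+1) q ^+ (j ^ 2) * (pe N * io N * (po j * ie j))).
Proof.
move=> hN; rewrite /c2 -sum1_card natr_sum.
under eq_bigl => jm do rewrite inE.
rewrite -(pair_big_dep xpredT (fun (j : 'I_K) (m : {ffun 'I_K -> 'I_K}) =>
  is_partition m && c2_cond j m) (fun _ _ => 1)) /=.
under eq_bigr => j _ do rewrite (c2_fiber j hN).
rewrite -raddf_sum; congr (phi _).
pose F j := q ^+ (j ^ 2) * (pe N * io N * (po j * ie j)).
rewrite -(big_mkord xpredT (fun j => if (0 < j)%N then F j else 0)).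
rewrite big_ltn //= add0r [RHS](@big_cat_nat _ _ _ K) //=; last by lia.
have -> : \sum_(K <= j < N.+1) F j = 0.
  rewrite big_nat big1 // => j /andP[hj _].
  by rewrite /F (expq_ge qK) ?mul0r //; nia.
rewrite addr0.
by rewrite !big_nat; apply: eq_bigr => j /andP[-> _].
Qed.

(** * Exponents modulo 5 and the parity of c_2 *)

Lemma phi_theta r : (n %% 5 = 2)%N -> phi (theta q r) = 0.
Proof.
move=> n5; rewrite /theta; case: r => [|r] /=.
  by rewrite mul1r expr0 mul1r phi_exp; case: eqP => // h; lia.
rewrite mulrDr mulr1 -!exprM -exprD !mulrDl -!exprD raddfD !phi_exp.
(* The exponents are 4t^2 - t and 4t^2 + t with t = r + 1; they are compared with 2 modulo 5 for
   each residue of r. *)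
have [h1 h2] : (r.+1 * r + 2 * r.+1 ^ 2 + r.+1 ^ 2 <> n /\
    r.+1 * r + 2 * r.+1 + 2 * r.+1 ^ 2 + r.+1 ^ 2 <> n)%N.
  rewrite (divn_eq r 5); have := ltn_pmod r (isT : 0 < 5)%N.
  move: (r %/ 5)%N (r %% 5)%N => k [|[|[|[|[|]]]]] // _; lia.
by rewrite (introF eqP h1) (introF eqP h2) addr0.
Qed.

Lemma phi_triangular s : (n %% 5 = 2)%N -> phi (q ^+ 'C(s.+1, 2)) = 0.
Proof.
move=> n5; rewrite phi_exp; case: eqP => // h; have := double_bin2 s.+1.
rewrite h {h} (divn_eq s 5); have := ltn_pmod s (isT : 0 < 5)%N.
move: (s %/ 5)%N (s %% 5)%N => k [|[|[|[|[|]]]]] // _; lia.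
Qed.

Lemma c2_even : (n %% 5 = 2)%N -> (c2 n)%:R = 0 :> 'F_2.
Proof.
move=> n5; have hN : (2 * K <= 2 * K)%N by [].
have := goellnitz_gordon char2 qK hN.
rewrite (c2_mod2 (N := 2 * K)); last by lia.
rewrite -(big_mkord xpredT (fun m =>
  q ^+ (m ^ 2) * (pe (2 * K) * io (2 * K) * (po m * ie m)))).
(* Split off the term m = 0, which c_2 lacks and which is Gauss's series; the rest is the generating
   function of c_2. *)
rewrite big_ltn //= => /(congr1 phi); rewrite raddfD.
have -> : q ^+ (0 ^ 2) * (pe (2 * K) * io (2 * K) * (po 0 * ie 0))
  = pe (2 * K) * io (2 * K).
  by rewrite /po /ie !big_ord0 !mulr1 mul1r.
rewrite gauss_triangular //; last by lia.
rewrite !raddf_sum big1 => [|s _]; last exact: phi_triangular.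
by rewrite add0r => ->; rewrite big1 // => r _; exact: phi_theta.
Qed.

End GeneratingFunction.

(** * The model F_2[X]/(X^(n+1)) with its coefficient map at X^n *)

Section TruncatedSeries.

Variable n : nat.

Local Notation trunc := {poly %/ ('X^(n.+1) : {poly 'F_2})}.

Definition trunc_coef (p : trunc) : 'F_2 := (p : {poly 'F_2})`_n.

Lemma trunc_coef_zmod_morphism : zmod_morphism trunc_coef.
Proof. by move=> p r; rewrite /trunc_coef -coefB. Qed.

HB.instance Definition _ :=
  GRing.isZmodMorphism.Build trunc 'F_2 trunc_coef trunc_coef_zmod_morphism.

Lemma trunc_expX m : ('qX : trunc) ^+ m = in_qpoly _ 'X^m.
Proof. by rewrite rmorphXn. Qed.

Lemma trunc_nilpotent : ('qX : trunc) ^+ n.+1 = 0.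
Proof.
rewrite trunc_expX; apply: val_inj; rewrite /= mk_monic_Xn /=.
by rewrite Pdiv.RingMonic.rmodpp ?monicXn.
Qed.

Lemma trunc_coef_exp m : trunc_coef ('qX ^+ m) = (m == n)%:R.
Proof.
case: (ltnP n m) => h.
  rewrite -(subnKC h) exprD trunc_nilpotent mul0r raddf0.
  by case: eqP => //; lia.
rewrite trunc_expX /trunc_coef in_qpoly_small ?coefXn 1?eq_sym //.
by rewrite mk_monic_Xn !size_polyXn.
Qed.

Lemma trunc_char2 : 2%N \in [pchar trunc].
Proof. by rewrite pchar_qpoly pchar_Fp. Qed.

End TruncatedSeries.

Local Close Scope ring_scope.

Theorem theorem2 (n : nat) : c2 (5 * n + 2) %% 2 = 0.
Proof.
set k := 5 * n + 2.
have even_c2 := @c2_even _ _ k (@trunc_coef k : {additive _ -> _}) (trunc_char2 k)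
  (trunc_nilpotent k) (@trunc_coef_exp k).
have : (c2 k)%:R%R = 0%R :> 'F_2 by apply: even_c2; rewrite /k; lia.
by move/(congr1 val); rewrite /= val_Fp_nat.
Qed.
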